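(* Let $p>3$ be a prime number. Then $$\sum_{\substack{0\le k\le p-1\\ k\text{ even}}}k\,H_k\equiv\frac{1}{4}\left(H'_{p-1}-1\right)\pmod p .$$
   Context: $H_k=\sum_{j=1}^{k}\frac1j$ denotes the $k$-th harmonic number, with $H_0:=0$. For an odd prime $p$, $H'_{p-1}:=1+\frac13+\frac15+\dots+\frac1{p-2}$ is the sum of the reciprocals of the odd integers between $1$ and $p-2$. Congruences modulo $p$ are between rational numbers whose denominators are prime to $p$ (i.e. congruences in the localization $\mathbb{Z}_{(p)}$). *)

(* Defs.v *)
From mathcomp Require Import all_boot all_order all_algebra.

Set Implicit Arguments.
Unset Strict Implicit.
Unset Printing Implicit Defensive.

Import Order.TTheory GRing.Theory Num.Theory.

Local Open Scope ring_scope.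

Definition harmonic (n : nat) : rat := \sum_(1 <= j < n.+1) (j%:R)^-1.

(* For n = p - 1 with p an odd prime, n is even and the last term is
   1 / (p - 2). *)
Definition odd_harmonic (n : nat) : rat :=
  \sum_(1 <= j < n.+1 | odd j) (j%:R)^-1.

(* Membership in the localization of Z at the prime p; [denq x] is the
   denominator of x in lowest terms. *)
Definition p_integral (p : nat) (x : rat) : bool := coprime `|denq x|%N p.

(* Congruence modulo the ideal generated by p in that localization; both
   sides are required to lie in the localization. *)
Definition eqmod_loc (p : nat) (x y : rat) : Prop :=
  [/\ p_integral p x, p_integral p y
    & exists2 z : rat, p_integral p z & x - y = p%:R * z].

(* Main.v *)
(** Exchanging the order of summation gives, for every [n],
      [sum_(k <= 2n, k even) k H_k = n (n + 1) H_(2n) - n (2n - 1) / 4 + H'_(2n) / 4],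
    where [H'_(2n)] runs over the odd integers.  For [p = 2n + 1] one has
    [H_(p-1) = 0 (mod p)], by pairing [1/j] with [1/(p-j)], and
    [n (2n - 1) / 4 = (p - 1)(p - 2) / 8], which is [1/4] modulo [p]. *)
Require Import Defs.
From HB Require Import structures.
From mathcomp Require Import all_boot all_order all_algebra.
From mathcomp Require Import ring.

Set Implicit Arguments.
Unset Strict Implicit.
Unset Printing Implicit Defensive.

Import Order.TTheory GRing.Theory Num.Theory.

Local Open Scope ring_scope.

(** Any denominator prime to [p] will do, reduced or not, so sums and products can be handled with
    the product of two denominators. *)
Lemma p_integralP (p : nat) (x : rat) :
  reflect (exists2 d : nat, coprime d p & d%:R * x \is a Num.int)
          (p_integral p x).
Proof.
apply: (iffP idP) => [xp | [d dp /intrP[m dx]]].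
  exists `|denq x|%N => //.
  by rewrite natr_absz gtr0_norm ?denq_gt0 // mulrC -numqE intr_int.
apply: coprime_dvdl dp.
have dnum : d%:Z * numq x = m * denq x.
  apply: (@intr_inj rat).
  by rewrite !rmorphM /= numqE -dx mulrA.
(* Since [denq x] is prime to [numq x], Gauss's lemma makes it divide [d]. *)
have : (`|denq x| %| d * `|numq x|)%N.
  by rewrite -[d]absz_nat -abszM dnum abszM dvdn_mull.
by rewrite Gauss_dvdl // coprime_sym coprime_num_den.
Qed.

Lemma p_integral_subring (p : nat) : subring_closed (p_integral p).
Proof.
split=> [|x y /p_integralP[d dp dx] /p_integralP[e ep ey]
         |x y /p_integralP[d dp dx] /p_integralP[e ep ey]].
- by apply/p_integralP; exists 1%N; rewrite ?coprime1n ?mulr1 ?rpred1.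
- apply/p_integralP; exists (d * e)%N; first by rewrite coprimeMl dp.
  have -> : (d * e)%:R * (x - y) = e%:R * (d%:R * x) - d%:R * (e%:R * y).
    by rewrite natrM; ring.
  by rewrite rpredB // rpredM // rpred_nat.
- apply/p_integralP; exists (d * e)%N; first by rewrite coprimeMl dp.
  by rewrite natrM mulrACA rpredM.
Qed.

HB.instance Definition _ (p : nat) :=
  GRing.isSubringClosed.Build rat (p_integral p) (@p_integral_subring p).

Lemma p_integral_natV (p d : nat) : coprime d p -> (d%:R : rat)^-1 \in p_integral p.
Proof.
move=> dp; apply/p_integralP; exists d => //.
(* [d = 0] can occur when [p = 1]; the inverse is then 0 by convention. *)
by have [->|d0] := eqVneq (d%:R : rat) 0; rewrite ?mul0r ?divff ?rpred0 ?rpred1.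
Qed.

Lemma prime_coprime_small (p j : nat) :
  prime p -> (0 < j < p)%N -> coprime j p.
Proof.
by move=> pp /andP[j0 jp]; rewrite coprime_sym prime_coprime // gtnNdvd.
Qed.

(** Induction checks the closed form: a step adds only the term [k = 2n + 2] on the left, while
    [harmonic] gains two reciprocals and [odd_harmonic] gains [1/(2n + 1)]. *)
Lemma sum_even_harmonic (n : nat) :
  \sum_(0 <= k < n.*2.+1 | ~~ odd k) k%:R * harmonic k =
  n%:R * (n%:R + 1) * harmonic n.*2 - n%:R * (2%:R * n%:R - 1) / 4%:R
  + odd_harmonic n.*2 / 4%:R.
Proof.
elim: n => [|n IHn].
  by rewrite /odd_harmonic big_mkcond big_nat1 /= !big_geq // !mul0r; ring.
have harmonicS m : harmonic m.+1 = harmonic m + (m.+1%:R)^-1.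
  by rewrite /harmonic big_nat_recr.
have odd_harmonicS m : odd_harmonic m.+1
    = odd_harmonic m + (if odd m.+1 then (m.+1%:R)^-1 else 0).
  by rewrite /odd_harmonic big_mkcond big_nat_recr //= -big_mkcond.
rewrite doubleS big_mkcond 2?big_nat_recr //= -big_mkcond /= IHn.
rewrite !odd_harmonicS !harmonicS /= odd_double /=.
have doubleR : n.*2%:R = 2%:R * n%:R :> rat by rewrite -mul2n natrM.
have n1 : 2%:R * n%:R + 1 != 0 :> rat by rewrite -doubleR natr1 pnatr_eq0.
have n2 : 2%:R * n%:R + 1 + 1 != 0 :> rat by rewrite -doubleR !natr1 pnatr_eq0.
rewrite -![_.+1%:R]natr1 doubleR.
by field; rewrite n1; move: n2; rewrite -addrA => ->.
Qed.

(** Reversing one copy of the sum pairs [1/j] with [1/(p - j)], and each pair adds up to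
    [p / (j (p - j))]. *)
Lemma harmonic_pred_reflect (p : nat) :
  harmonic p.-1 + harmonic p.-1
  = p%:R * \sum_(1 <= j < p) ((j%:R)^-1 * ((p - j)%:R)^-1).
Proof.
case: p => [|p]; first by rewrite /harmonic !big_geq // mul0r addr0.
rewrite {2}/harmonic big_nat_rev /harmonic -big_split mulr_sumr /=.
apply: eq_big_nat => j /andP[j0 jp].
rewrite add1n subSS.
have jR : (j%:R : rat) != 0 by rewrite pnatr_eq0 -lt0n.
have kR : ((p.+1 - j)%:R : rat) != 0 by rewrite pnatr_eq0 -lt0n subn_gt0.
(* Writing the factor [p.+1] as [(p.+1 - j) + j] lets [field] treat the truncated subtraction as an
   atom. *)
rewrite -[in p.+1%:R](subnK (ltnW jp)) natrD.
by field; rewrite jR kR.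
Qed.

Theorem corollary1 (p : nat) (p_prime : prime p) (p_gt3 : (3 < p)%N) :
  eqmod_loc p
    (\sum_(0 <= k < p | ~~ odd k) k%:R * harmonic k)
    (4%:R^-1 * (odd_harmonic p.-1 - 1)).
Proof.
have p_odd : odd p by case: (even_prime p_prime) p_gt3 => [->|].
have invP j : (0 < j < p)%N -> (j%:R : rat)^-1 \in p_integral p.
  by move=> jp; apply/p_integral_natV/prime_coprime_small.
have inv2 : (2%:R : rat)^-1 \in p_integral p by apply/invP/ltnW.
have inv4 : (4%:R : rat)^-1 \in p_integral p.
  (* [invP] would require [4 < p]; squaring the inverse of 2 avoids this. *)
  by rewrite -[4%N]/(2 * 2)%N natrM invfM rpredM.
split.
- rewrite -[p_integral p _]/(_ \in p_integral p) big_nat_cond.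
  apply: rpred_sum => k /andP[/andP[_ kp] _]; rewrite rpredM ?rpred_nat //.
  rewrite /harmonic big_nat; apply: rpred_sum => j /andP[j0 jk].
  by rewrite invP // j0 (leq_trans jk).
- rewrite -[p_integral p _]/(_ \in p_integral p) rpredM // rpredB ?rpred1 //.
  rewrite /odd_harmonic prednK ?prime_gt0 // big_nat_cond.
  by apply: rpred_sum => j /andP[/invP].
pose h : rat := \sum_(1 <= j < p) ((j%:R)^-1 * ((p - j)%:R)^-1).
(* With [n = (p - 1)/2], [n (n + 1) = (p^2 - 1)/4] multiplies [harmonic p.-1 = p h / 2], and
   [(p - 1)(p - 2)/8 - 1/4 = p (p - 3)/8]; dividing by [p] gives the two terms. *)
exists ((p%:R ^+ 2 - 1) * 4%:R^-1 * 2%:R^-1 * h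
        - (p%:R - 3%:R) * 4%:R^-1 * 2%:R^-1).
  have hP : h \in p_integral p.
    rewrite /h big_nat; apply: rpred_sum => j /andP[j0 jp].
    by rewrite rpredM ?invP ?j0 // subn_gt0 jp ltn_subrL j0 prime_gt0.
  rewrite -[p_integral p _]/(_ \in p_integral p).
  by rewrite !(rpredB, rpredM, rpredX, rpred1, rpred_nat).
have pE : p = p./2.*2.+1 by rewrite -[LHS]odd_double_half p_odd.
have hE : harmonic p.-1 = p%:R * h / 2%:R.
  by rewrite -harmonic_pred_reflect; field.
have nE : (p./2%:R : rat) = (p%:R - 1) / 2%:R.
  by rewrite [in RHS]pE -addn1 -mul2n natrD natrM; field.
have dE : p./2.*2 = p.-1 by rewrite [in RHS]pE.
by rewrite [in X in X - _]pE sum_even_harmonic dE hE nE; field.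
Qed.
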